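(* Consider the parabolic joint operator $-\partial_t+\mathcal L_{\phi,x}=-\partial_t+\hat D_0+\frac12\sum_{r=1}^k\tilde D_r^2$ on $\mathbb R\times(0,\infty)^n\times\mathbb R^k$. (1) Hörmander's condition fails for this operator in each of the following two cases: (a) $Q=0$; (b) for every $j\in\{1,\dots,n\}$ one has $q_{mj}=0$ for all $m\in\{0,\dots,n\}$ with $m\ne j$, and $q_{j0}>0$ for at least one $j\in\{1,\dots,n\}$. (2) Assume that $a_0,a_1,\dots,a_n$ are pairwise distinct and that for each $i\in\{1,\dots,n\}$ there is an $m\in\{0,\dots,n\}$, $m\neq i$, such that $q_{mi}>0$ and such that, for all $p,j\in\{0,\dots,n\}$, $q_{pj}>0$ and $a_p-a_j=a_m-a_i$ imply $j=i$. Then Hörmander's condition holds for this operator.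
   Context: Let $1\le k<n$ be integers. Let $Q=(q_{ij})_{i,j=0}^n$ be a real matrix with $q_{ij}\ge0$ for $i\ne j$, $q_{ii}\le0$, and $\sum_{j=0}^nq_{ij}=0$ for every $i$. Let $\lambda_0,\dots,\lambda_n\in\mathbb R^k$ be pairwise distinct, with $\lambda_0$ a vertex of their convex hull; write $\lambda_{ir}$ for the $r$-th component of $\lambda_i$. Put $a_i:=\lambda_i-\lambda_0$ for $0\le i\le n$ (so $a_0=0$), with components $a_{ir}$ ($1\le r\le k$), and $\Sigma_{ij}:=a_i\cdot a_j$. For $\phi\in(0,\infty)^n$ let $\phi_0:=1$ and $y(\phi):=1+\sum_{i=1}^n\phi_i$. Define vector fields on $(0,\infty)^n$: $$D_r=\sum_{j=1}^na_{jr}\phi_j\,\partial_{\phi_j}\ (1\le r\le k),\qquad D_0=\sum_{j=1}^n\Big(\frac1{y(\phi)}\sum_{i=1}^n\Sigma_{ij}\phi_i\phi_j-\frac12\|a_j\|^2\phi_j\Big)\partial_{\phi_j},$$ $$J=\sum_{j=1}^n\sum_{i=0}^n(q_{ij}-q_{i0}\phi_j)\phi_i\,\partial_{\phi_j},\qquad D_0^J=D_0+J.$$ On $(0,\infty)^n\times\mathbb R^k$ (coordinates $(\phi,x)$) define $$\tilde\lambda_r(\phi)=\frac1{y(\phi)}\Big(\lambda_{0r}+\sum_{i=1}^n\lambda_{ir}\phi_i\Big),\quad \tilde D_r=D_r+\partial_{x_r},\quad \hat D_0=D_0^J+\sum_{r=1}^k\tilde\lambda_r(\phi)\,\partial_{x_r},\quad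 \mathcal L_{\phi,x}=\hat D_0+\frac12\sum_{r=1}^k\tilde D_r^2.$$ These are also regarded as vector fields on $\mathbb R\times(0,\infty)^n\times\mathbb R^k$ with zero $\partial_t$ component. Lie bracket: $[F,G]=FG-GF$. Hörmander's condition holds for $-\partial_t+\mathcal L_{\phi,x}$ if at every point of $\mathbb R\times(0,\infty)^n\times\mathbb R^k$ the values of $-\partial_t+\hat D_0,\tilde D_1,\dots,\tilde D_k$ and of all their iterated Lie brackets span $\mathbb R^{1+n+k}$; otherwise it fails. *)

(* Defs.v *)
From HB Require Import structures.
From mathcomp Require Import all_boot all_order all_algebra.
From mathcomp Require Import all_classical all_reals all_analysis.

Set Implicit Arguments.
Unset Strict Implicit.
Unset Printing Implicit Defensive.

Import Order.TTheory GRing.Theory Num.Theory.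
Import numFieldNormedType.Exports.

Local Open Scope classical_set_scope.
Local Open Scope ring_scope.

(* A vector field on an open subset of R^m is represented by its coefficients,
   as a total function; its values off the open set are irrelevant, since the
   derivatives below only depend on germs. *)
Definition vfield (R : realType) (m : nat) := 'rV[R]_m -> 'rV[R]_m.

(* F f = \sum_l F_l (df / dx_l) *)
Definition vf_apply (R : realType) (m : nat) (F : vfield R m)
    (f : 'rV[R]_m -> R) (p : 'rV[R]_m) : R :=
  \sum_(l < m) F p 0 l * 'D_(delta_mx 0 l) f p.

(* FG - GF, whose i-th coefficient is its value on the i-th coordinate
   function. *)
Definition lie_bracket (R : realType) (m : nat) (F G : vfield R m) :
    vfield R m :=
  fun p => \row_i (vf_apply F (fun q => G q 0 i) p
                   - vf_apply G (fun q => F q 0 i) p).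

Inductive iterated_bracket (R : realType) (m : nat) (S : set (vfield R m)) :
    vfield R m -> Prop :=
| iterated_bracket_gen F : S F -> iterated_bracket S F
| iterated_bracket_lie F G : iterated_bracket S F -> iterated_bracket S G ->
    iterated_bracket S (lie_bracket F G).

(* Hörmander's condition on U for the operator X0 + 1/2 \sum_r (X r)^2. *)
Definition hormander (R : realType) (m d : nat) (U : set 'rV[R]_m)
    (X0 : vfield R m) (X : 'I_d -> vfield R m) : Prop :=
  forall p, U p ->
    exists s : seq 'rV[R]_m,
      (forall v, v \in s ->
         exists2 F, iterated_bracket ([set X0] `|` range X) F & v = F p)
      /\ span s = fullv.

Definition convex_hull (R : realType) (N k : nat) (u : 'I_N -> 'rV[R]_k) :
    set 'rV[R]_k :=
  [set z | exists w : 'I_N -> R,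
     [/\ forall i, 0 <= w i, \sum_i w i = 1 & z = \sum_i w i *: u i]].

(* v is a vertex (extreme point) of the convex set A. *)
Definition vertex (R : realType) (k : nat) (A : set 'rV[R]_k)
    (v : 'rV[R]_k) : Prop :=
  A v /\ forall x z (t : R), A x -> A z -> 0 < t < 1 ->
    v = t *: x + (1 - t) *: z -> x = v /\ z = v.

(* The matrix norm of the library is the sup norm, so Euclidean norms are
   written with dot. *)
Definition dot (R : realType) (k : nat) (u v : 'rV[R]_k) : R :=
  \sum_(r < k) u 0 r * v 0 r.

(* Indices 0, ..., n have type 'I_n.+1; the index written j in 1, ..., n is
   lift ord0 j with j : 'I_n. *)

Definition avec (R : realType) (n k : nat) (lam : 'I_n.+1 -> 'rV[R]_k)
    (i : 'I_n.+1) : 'rV[R]_k :=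
  lam i - lam ord0.

Definition Sigma (R : realType) (n k : nat) (lam : 'I_n.+1 -> 'rV[R]_k)
    (i j : 'I_n.+1) : R :=
  dot (avec lam i) (avec lam j).

(* phi_0 = 1 *)
Definition phi_ext (R : realType) (n : nat) (phi : 'rV[R]_n) (i : 'I_n.+1) :
    R :=
  if unlift ord0 i is Some j then phi 0 j else 1.

Definition ysum (R : realType) (n : nat) (phi : 'rV[R]_n) : R :=
  1 + \sum_(i < n) phi 0 i.

Definition fieldD (R : realType) (n k : nat) (lam : 'I_n.+1 -> 'rV[R]_k)
    (r : 'I_k) : vfield R n :=
  fun phi => \row_j (avec lam (lift ord0 j) 0 r * phi 0 j).

Definition fieldD0 (R : realType) (n k : nat) (lam : 'I_n.+1 -> 'rV[R]_k) :
    vfield R n :=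
  fun phi => \row_j
    ((ysum phi)^-1
       * (\sum_(i < n) Sigma lam (lift ord0 i) (lift ord0 j)
                         * phi 0 i * phi 0 j)
     - 2^-1 * dot (avec lam (lift ord0 j)) (avec lam (lift ord0 j))
         * phi 0 j).

Definition fieldJ (R : realType) (n : nat) (Q : 'M[R]_n.+1) : vfield R n :=
  fun phi => \row_j
    \sum_(i < n.+1) (Q i (lift ord0 j) - Q i ord0 * phi 0 j) * phi_ext phi i.

Definition fieldD0J (R : realType) (n k : nat) (Q : 'M[R]_n.+1)
    (lam : 'I_n.+1 -> 'rV[R]_k) : vfield R n :=
  fun phi => fieldD0 lam phi + fieldJ Q phi.

Definition lambda_tilde (R : realType) (n k : nat)
    (lam : 'I_n.+1 -> 'rV[R]_k) (phi : 'rV[R]_n) (r : 'I_k) : R :=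
  (ysum phi)^-1
    * (lam ord0 0 r + \sum_(i < n) lam (lift ord0 i) 0 r * phi 0 i).

(* A point (phi, x) is row_mx phi x : 'rV_(n + k), and (t, phi, x) is
   row_mx t%:M (row_mx phi x) : 'rV_(1 + (n + k)). *)

Definition fieldD_tilde (R : realType) (n k : nat)
    (lam : 'I_n.+1 -> 'rV[R]_k) (r : 'I_k) : vfield R (n + k) :=
  fun z => row_mx (fieldD lam r (lsubmx z)) (delta_mx 0 r).

Definition fieldD0_hat (R : realType) (n k : nat) (Q : 'M[R]_n.+1)
    (lam : 'I_n.+1 -> 'rV[R]_k) : vfield R (n + k) :=
  fun z => row_mx (fieldD0J Q lam (lsubmx z))
                  (\row_r lambda_tilde lam (lsubmx z) r).

(* c d/dt + F, for c constant and F a field in the variable (phi, x) *)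
Definition with_time (R : realType) (m : nat) (c : R) (F : vfield R m) :
    vfield R (1 + m) :=
  fun p => row_mx c%:M (F (rsubmx p)).

(* R x (0, oo)^n x R^k *)
Definition joint_domain (R : realType) (n k : nat) :
    set 'rV[R]_(1 + (n + k)) :=
  [set p | forall j : 'I_n, 0 < lsubmx (rsubmx p) 0 j].

Definition joint_hormander (R : realType) (n k : nat) (Q : 'M[R]_n.+1)
    (lam : 'I_n.+1 -> 'rV[R]_k) : Prop :=
  hormander (@joint_domain R n k)
    (with_time (-1) (fieldD0_hat Q lam))
    (fun r => with_time 0 (fieldD_tilde lam r)).

(* Main.v *)
(* In the coordinates t, w_j = log phi_j - a_j . x, x, the fields tilde D_r become
   d/dx_r and the w_j-component of hat D_0 becomes the exponential sum
     const + sum_i q_ij phi_i / phi_j - sum_i q_i0 phi_i,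
   where phi_i = exp (w_i + a_i . x).
   (1) In both cases it is const - sum_i q_i0 phi_i, whose second term does not
   depend on j, so w_1 - w_2 minus a linear function of t is a first integral.
   (2) Bracketing repeatedly with the d/dx_r multiplies the terms of frequency
   a_i - a_j by products of coordinates of a_i - a_j, hence the brackets span
   each nonzero frequency separately, and by hypothesis the frequency a_m - a_i
   occurs in the w_i-component only.
   Instead of changing coordinates, the proof applies the closed 1-forms with
   constant coefficients in dt, dlog phi_j, dx_r to the brackets. *)
Require Import Defs.
From HB Require Import structures.
From mathcomp Require Import all_boot all_order all_algebra.
From mathcomp Require Import all_classical all_reals all_analysis.
From mathcomp Require Import ring.

Set Implicit Arguments.
Unset Strict Implicit.
Unset Printing Implicit Defensive.

Import Order.TTheory GRing.Theory Num.Theory.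
Import numFieldNormedType.Exports.

Local Open Scope classical_set_scope.
Local Open Scope ring_scope.

(** * Calculus of vector fields on an open set *)

Section Smooth.
Context {R : realType} {N : nat}.
Variable U : set 'rV[R]_N.
Hypothesis Uo : open U.
Implicit Types (f g : 'rV[R]_N -> R) (F G : vfield R N) (p : 'rV[R]_N).

(** Openness of [U] turns equality on [U] into equality of germs, so formulas valid only on [U] may
    be differentiated there. *)
Lemma eq_on_near f g p : U p -> (forall q, U q -> f q = g q) ->
  {near p, f =1 g}.
Proof.
move=> Up fg; near=> q; apply: fg; near: q.
exact: open_nbhs_nbhs.
Unshelve. all: by end_near. Qed.

Definition pderivable f := forall p, U p -> forall l, derivable f p (delta_mx 0 l).

(** Level [d] records the existence on [U] of iterated coordinate partials up to order [d.+1]. This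
    suffices for the Leibniz rules of [vf_apply]. A bracket costs one order, so [smooth] asks for
    every level. *)
Fixpoint smooth_upto (d : nat) f : Prop :=
  pderivable f /\
  if d is d'.+1 then
    forall l, smooth_upto d' (fun p => 'D_(delta_mx 0 l) f p)
  else True.

Definition smooth f := forall d, smooth_upto d f.

Lemma smooth_upto_derivable d f : smooth_upto d f -> pderivable f.
Proof. by case: d => [|d] []. Qed.

Lemma smooth_uptoW d f : smooth_upto d.+1 f -> smooth_upto d f.
Proof.
elim: d f => [|d IH] f [df Df]; split=> // l.
exact: IH.
Qed.

Lemma pderivable_congr f g : (forall p, U p -> f p = g p) ->
  pderivable f -> pderivable g.
Proof.
move=> fg df p Up l; apply: near_eq_derivable (df p Up l).
exact: eq_on_near.
Qed.

Lemma partial_congr f g v : (forall p, U p -> f p = g p) ->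
  forall p, U p -> 'D_v f p = 'D_v g p.
Proof. by move=> fg p Up; apply: near_eq_derive; exact: eq_on_near. Qed.

Lemma smooth_upto_congr d f g : (forall p, U p -> f p = g p) ->
  smooth_upto d f -> smooth_upto d g.
Proof.
elim: d f g => [|d IH] f g fg [df Df]; split.
- exact: pderivable_congr df.
- by [].
- exact: pderivable_congr df.
- by move=> l; apply: IH (Df l); exact: partial_congr.
Qed.

Lemma smooth_upto_cst d c : smooth_upto d (fun=> c).
Proof.
have dc c' : pderivable (fun=> c') by move=> p _ l; exact: derivable_cst.
elim: d c => [|d IH] c; split; [exact: dc|by []|exact: dc|].
move=> l; apply: smooth_upto_congr (IH 0) => p _.
by rewrite derive_cst.
Qed.

Lemma derivable_coord (i : 'I_N) p v :
  derivable (fun q : 'rV[R]_N => q 0 i) p v.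
Proof. exact/diff_derivable/differentiable_coord. Qed.

Lemma derive_coord (i : 'I_N) p v : 'D_v (fun q : 'rV[R]_N => q 0 i) p = v 0 i.
Proof.
have := congr1 (fun M : 'rV[R]_N => M 0 i) (@derive_id R _ p v).
rewrite /= derive_mx; last exact: derivable_id.
by rewrite mxE.
Qed.

Lemma smooth_upto_coord d (i : 'I_N) : smooth_upto d (fun p => p 0 i).
Proof.
have di : pderivable (fun p => p 0 i) by move=> p _ l; exact: derivable_coord.
case: d => [|d]; split; [exact: di|by []|exact: di|].
move=> l; apply: smooth_upto_congr (smooth_upto_cst d _) => p _.
by rewrite derive_coord.
Qed.

Lemma smooth_uptoD d f g : smooth_upto d f -> smooth_upto d g ->
  smooth_upto d (fun p => f p + g p).
Proof.
elim: d f g => [|d IH] f g [df Df] [dg Dg]; split.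
- by move=> p Up l; apply: derivableD; [exact: df|exact: dg].
- by [].
- by move=> p Up l; apply: derivableD; [exact: df|exact: dg].
- move=> l; apply: smooth_upto_congr (IH _ _ (Df l) (Dg l)) => p Up.
  by rewrite deriveD; [|exact: df|exact: dg].
Qed.

Lemma smooth_uptoM d f g : smooth_upto d f -> smooth_upto d g ->
  smooth_upto d (fun p => f p * g p).
Proof.
elim: d f g => [|d IH] f g sf sg; have [df Df] := sf; have [dg Dg] := sg.
  split; last by [].
  by move=> p Up l; apply: derivableM; [exact: df|exact: dg].
split; first by move=> p Up l; apply: derivableM; [exact: df|exact: dg].
move=> l; have := smooth_uptoD (IH _ _ (smooth_uptoW sf) (Dg l))
                    (IH _ _ (smooth_uptoW sg) (Df l)).
apply: smooth_upto_congr => p Up.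
by rewrite deriveM; [|exact: df|exact: dg].
Qed.

Lemma smooth_uptoV d f : (forall p, U p -> f p != 0) -> smooth_upto d f ->
  smooth_upto d (fun p => (f p)^-1).
Proof.
move=> f0; elim: d f f0 => [|d IH] f f0 sf; have [df Df] := sf.
  split; last by [].
  by move=> p Up l; apply: derivableV; [exact: f0|exact: df].
split; first by move=> p Up l; apply: derivableV; [exact: f0|exact: df].
move=> l; have sV := IH f f0 (smooth_uptoW sf).
(* A partial of [1/f] is [-(1/f)(1/f)] times that of [f], so the induction reuses [1/f] one level
   lower. *)
have := smooth_uptoM (smooth_upto_cst d (-1))
  (smooth_uptoM (smooth_uptoM sV sV) (Df l)).
apply: smooth_upto_congr => p Up.
rewrite deriveV; [|exact: f0|exact: df].
by rewrite mulN1r -invfM scaleNr.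
Qed.

Lemma smooth_cst c : smooth (fun=> c).
Proof. by move=> d; exact: smooth_upto_cst. Qed.

Lemma smooth_coord (i : 'I_N) : smooth (fun p => p 0 i).
Proof. by move=> d; exact: smooth_upto_coord. Qed.

Lemma smoothD f g : smooth f -> smooth g -> smooth (fun p => f p + g p).
Proof. by move=> sf sg d; exact: smooth_uptoD. Qed.

Lemma smoothM f g : smooth f -> smooth g -> smooth (fun p => f p * g p).
Proof. by move=> sf sg d; exact: smooth_uptoM. Qed.

Lemma smoothV f : (forall p, U p -> f p != 0) -> smooth f ->
  smooth (fun p => (f p)^-1).
Proof. by move=> f0 sf d; exact: smooth_uptoV. Qed.

Lemma smooth_congr f g : (forall p, U p -> f p = g p) -> smooth f -> smooth g.
Proof. by move=> fg sf d; exact: smooth_upto_congr (sf d). Qed.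

Lemma smoothN f : smooth f -> smooth (fun p => - f p).
Proof.
move=> sf; apply: smooth_congr (smoothM (smooth_cst (-1)) sf) => p _.
by rewrite mulN1r.
Qed.

Lemma smooth_sum (I : Type) (s : seq I) (h : I -> 'rV[R]_N -> R) :
  (forall i, smooth (h i)) -> smooth (fun p => \sum_(i <- s) h i p).
Proof.
move=> sh; elim: s => [|i s IH].
  by apply: smooth_congr (smooth_cst 0) => p _; rewrite big_nil.
by apply: smooth_congr (smoothD (sh i) IH) => p _; rewrite big_cons.
Qed.

Lemma smooth_partial f l : smooth f ->
  smooth (fun p => 'D_(delta_mx 0 l) f p).
Proof. by move=> sf d; case: (sf d.+1) => _; apply. Qed.

Lemma smooth_pderivable f : smooth f -> pderivable f.
Proof. by move=> sf; exact: smooth_upto_derivable (sf 0%N). Qed.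

Definition smooth_field F := forall i, smooth (fun p => F p 0 i).

Lemma smooth_vf_apply F f : smooth_field F -> smooth f ->
  smooth (vf_apply F f).
Proof.
move=> sF sf; apply: smooth_sum => l.
by apply: smoothM; [exact: sF|exact: smooth_partial].
Qed.

Lemma smooth_lie F G : smooth_field F -> smooth_field G ->
  smooth_field (lie_bracket F G).
Proof.
move=> sF sG i.
have := smoothD (smooth_vf_apply sF (sG i)) (smoothN (smooth_vf_apply sG (sF i))).
by apply: smooth_congr => p _; rewrite mxE.
Qed.

Lemma vf_apply_congr F f g p : U p -> (forall q, U q -> f q = g q) ->
  vf_apply F f p = vf_apply F g p.
Proof.
move=> Up fg; apply: eq_bigr => l _; congr (_ * _).
exact: partial_congr.
Qed.

Lemma vf_apply_cst F c p : vf_apply F (fun=> c) p = 0.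
Proof. by apply: big1 => l _; rewrite derive_cst mulr0. Qed.

Lemma vf_apply_coord F (i : 'I_N) p :
  vf_apply F (fun q => q 0 i) p = F p 0 i.
Proof.
rewrite /vf_apply (bigD1 i) //= derive_coord mxE !eqxx mulr1.
rewrite big1 ?addr0 // => l li.
by rewrite derive_coord mxE eq_sym (negPf li) andbF mulr0.
Qed.

Lemma vf_applyD F f g p : U p -> smooth f -> smooth g ->
  vf_apply F (fun q => f q + g q) p = vf_apply F f p + vf_apply F g p.
Proof.
move=> Up sf sg; rewrite /vf_apply -big_split; apply: eq_bigr => l _ /=.
by rewrite -mulrDr deriveD; [|exact: smooth_pderivable|exact: smooth_pderivable].
Qed.

Lemma vf_applyM F f g p : U p -> smooth f -> smooth g ->
  vf_apply F (fun q => f q * g q) p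
  = f p * vf_apply F g p + g p * vf_apply F f p.
Proof.
move=> Up sf sg; rewrite /vf_apply !mulr_sumr -big_split.
apply: eq_bigr => l _ /=.
rewrite deriveM; [|exact: smooth_pderivable|exact: smooth_pderivable].
by rewrite mulrDr ![F p 0 l * _]mulrCA.
Qed.

Lemma vf_applyZ F c f p : U p -> smooth f ->
  vf_apply F (fun q => c * f q) p = c * vf_apply F f p.
Proof.
move=> Up sf; rewrite (vf_applyM F Up (smooth_cst c) sf).
by rewrite vf_apply_cst mulr0 addr0.
Qed.

Lemma vf_apply_sum F (I : Type) (s : seq I) (h : I -> 'rV[R]_N -> R) p :
  U p -> (forall i, smooth (h i)) ->
  vf_apply F (fun q => \sum_(i <- s) h i q) p = \sum_(i <- s) vf_apply F (h i) p.
Proof.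
move=> Up sh; elim: s => [|i s IH].
  rewrite big_nil -[RHS](vf_apply_cst F 0 p).
  by apply: vf_apply_congr => // q _; rewrite big_nil.
rewrite big_cons -IH -(vf_applyD F Up (sh i) (smooth_sum s sh)).
by apply: vf_apply_congr => // q _; rewrite big_cons.
Qed.

Lemma vf_applyV F f p : U p -> (forall q, U q -> f q != 0) -> smooth f ->
  vf_apply F (fun q => (f q)^-1) p = - (f p)^-2 * vf_apply F f p.
Proof.
move=> Up f0 sf; rewrite /vf_apply mulr_sumr; apply: eq_bigr => l _.
rewrite deriveV; [|exact: f0|exact: smooth_pderivable].
by rewrite mulrCA.
Qed.

(** * Closed logarithmic 1-forms *)

Section LogForm.
Variable e : 'I_N -> bool.
Hypothesis e0 : forall p i, U p -> e i -> p 0 i != 0.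

(** Dividing by this factor turns [d p_i] into [d log p_i] where [e i] holds and leaves it unchanged
    elsewhere, without introducing logarithms. *)
Definition logscale (i : 'I_N) p := if e i then p 0 i else 1.

Lemma smooth_logscale i : smooth (logscale i).
Proof.
rewrite /logscale; case: (e i); [exact: smooth_coord|exact: smooth_cst].
Qed.

Lemma logscale_neq0 i p : U p -> logscale i p != 0.
Proof.
by rewrite /logscale => Up; case: ifPn => [/(e0 Up)|_] //; rewrite oner_eq0.
Qed.

Lemma smooth_logscaleV i : smooth (fun q => (logscale i q)^-1).
Proof.
apply: smoothV; last exact: smooth_logscale.
by move=> q; exact: logscale_neq0.
Qed.

Lemma vf_apply_logscale F i p :
  vf_apply F (logscale i) p = if e i then F p 0 i else 0.
Proof.
rewrite /logscale; case: (e i); [exact: vf_apply_coord|exact: vf_apply_cst].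
Qed.

(* The 1-form with constant coefficients xi in the d log p_i (where e i) and
   the d p_i (elsewhere), applied to F. *)
Definition log_form (xi : 'I_N -> R) F p : R :=
  \sum_i xi i * (F p 0 i / logscale i p).

Lemma smooth_log_coef F i : smooth_field F ->
  smooth (fun p => F p 0 i / logscale i p).
Proof.
by move=> sF; apply: smoothM; [exact: sF|exact: smooth_logscaleV].
Qed.

(** Differentiating the denominator contributes [- F_i G_i / p_i^2] where [e i] holds; this is
    symmetric in [F] and [G] and cancels in the difference. *)
Lemma log_coef_bracket F G i p : U p -> smooth_field F -> smooth_field G ->
  lie_bracket F G p 0 i / logscale i p
  = vf_apply F (fun q => G q 0 i / logscale i q) p
    - vf_apply G (fun q => F q 0 i / logscale i q) p.
Proof.
move=> Up sF sG; rewrite mxE.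
have aV H : vf_apply H (fun q => (logscale i q)^-1) p
    = - (logscale i p)^-2 * (if e i then H p 0 i else 0).
  rewrite (vf_applyV H Up _ (smooth_logscale i)) ?vf_apply_logscale //.
  by move=> q; exact: logscale_neq0.
rewrite (vf_applyM F Up (sG i) (smooth_logscaleV i)).
rewrite (vf_applyM G Up (sF i) (smooth_logscaleV i)) !aV.
by case: (e i); ring.
Qed.

(* The form is closed. *)
Lemma log_form_bracket xi F G p : U p -> smooth_field F -> smooth_field G ->
  log_form xi (lie_bracket F G) p
  = vf_apply F (log_form xi G) p - vf_apply G (log_form xi F) p.
Proof.
move=> Up sF sG.
have sc H i : smooth_field H -> smooth (fun q => xi i * (H q 0 i / logscale i q)).
  by move=> sH; apply: smoothM; [exact: smooth_cst|exact: smooth_log_coef].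
rewrite /log_form (vf_apply_sum F _ Up (fun i => sc G i sG)).
rewrite (vf_apply_sum G _ Up (fun i => sc F i sF)) -sumrB.
apply: eq_bigr => i _.
rewrite (vf_applyZ F (xi i) Up (smooth_log_coef i sG)).
rewrite (vf_applyZ G (xi i) Up (smooth_log_coef i sF)).
by rewrite -mulrBr -log_coef_bracket.
Qed.

(* A common first integral which is linear in these coordinates is inherited
   by brackets. *)
Lemma log_form_iterated (S : set (vfield R N)) xi F :
  (forall H, S H -> smooth_field H) ->
  (forall H, S H -> forall p, U p -> log_form xi H p = 0) ->
  iterated_bracket S F ->
  smooth_field F /\ forall p, U p -> log_form xi F p = 0.
Proof.
move=> sS S0; elim=> {F} [F SF|F G _ [sF F0] _ [sG G0]].
  by split; [exact: sS|exact: S0].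
split; first exact: smooth_lie.
move=> p Up; rewrite (log_form_bracket xi Up sF sG).
rewrite (vf_apply_congr F Up G0) (vf_apply_congr G Up F0).
by rewrite !vf_apply_cst subrr.
Qed.

End LogForm.

End Smooth.

(** * Spanning tested by annihilating covectors, and separation of atoms by moments *)

Lemma span_full_annihilator (K : fieldType) (m : nat) (s : seq 'rV[K]_m)
    (xi : 'I_m -> K) :
  span s = fullv -> (forall v, v \in s -> \sum_i xi i * v 0 i = 0) ->
  forall i, xi i = 0.
Proof.
move=> sfull s0 i.
have : delta_mx 0 i \in span (in_tuple s) by rewrite sfull memvf.
move=> /coord_span; set c := coord _ => dE.
have : \sum_l xi l * (delta_mx 0 i : 'rV[K]_m) 0 l = 0.
  rewrite dE; under eq_bigr => l _ do rewrite summxE mulr_sumr.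
  rewrite exchange_big big1 //= => j _.
  under eq_bigr => l _ do rewrite mxE mulrCA.
  by rewrite -mulr_sumr s0 ?mulr0 //; apply: mem_nth.
rewrite (bigD1 i) //= mxE !eqxx mulr1 big1 ?addr0 // => l li.
by rewrite mxE (negPf li) andbF mulr0.
Qed.

(** [S] may be infinite, so a finite family in [S] of maximal rank is chosen, as the rows of a
    matrix [A]; it already spans everything that [S] does. *)
Lemma span_full_of_annihilator (K : fieldType) (m : nat) (S : set 'rV[K]_m) :
  (forall xi : 'I_m -> K,
     (forall v, S v -> \sum_i xi i * v 0 i = 0) -> forall i, xi i = 0) ->
  exists s : seq 'rV[K]_m, (forall v, v \in s -> S v) /\ span s = fullv.
Proof.
move=> S0.
pose P d := `[< exists r, exists2 A : 'M[K]_(r, m),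
                  (forall i, S (row i A)) & \rank A = d >].
have P0 : exists d, P d.
  exists 0%N; apply/asboolP; exists 0%N, 0; last by rewrite mxrank0.
  by case.
have Pm d : P d -> (d <= m)%N.
  by move=> /asboolP[r [A _ <-]]; exact: rank_leq_col.
case: (ex_maxnP P0 Pm) => d /asboolP[r [A SA rkA]] maxd.
(* Adjoining [v] to the rows of [A] cannot raise the maximal rank. *)
have SleA v : S v -> (v <= A)%MS.
  move=> Sv; have : P (\rank (col_mx A v)).
    apply/asboolP; exists (r + 1)%N, (col_mx A v) => // i.
    by case: (split_ordP i) => j ->; rewrite ?rowKu ?rowKd // row_id.
  move=> /maxd; rewrite -rkA => rk.
  have AleAv : (A <= col_mx A v)%MS by rewrite -addsmxE addsmxSl.
  apply: submx_trans (_ : (col_mx A v <= A)%MS).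
    by rewrite -addsmxE addsmxSr.
  by rewrite -(geq_leqif (mxrank_leqif_sup AleAv)).
have Afull : row_full A.
  (* A covector killing the rows of [A] kills [S], hence is zero by hypothesis; so the kernel of
     [A^T] is trivial. *)
  rewrite /row_full -mxrank_tr -[_ == _]/(row_free A^T) -kermx_eq0; apply/eqP/row_matrixP => i.
  rewrite row0; apply/rowP => j; rewrite [RHS]mxE.
  apply: (S0 (fun j => row i (kermx A^T) 0 j)) => v /SleA/submxP[w ->].
  have /(congr1 trmx) : row i (kermx A^T) *m A^T = 0.
    by rewrite -row_mul mulmx_ker row0.
  rewrite trmx_mul trmxK trmx0 => A0.
  have /(congr1 (fun M : 'M[K]_(1, 1) => M 0 0)) : w *m A *m (row i (kermx A^T))^T = 0.
    by rewrite -mulmxA A0 mulmx0.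
  rewrite mxE [RHS]mxE => wAx; rewrite -[RHS]wAx; apply: eq_bigr => l _.
  by rewrite mulrC; congr (_ * _); rewrite [RHS]mxE.
exists [seq row i A | i <- enum 'I_r]; split; first by move=> v /mapP[i _ ->].
apply/eqP; rewrite eqEsubv subvf /=; apply/subvP => v _.
have /submxP[w ->] : (v <= A)%MS by exact: submx_full.
rewrite mulmx_sum_row; apply: memv_suml => i _; apply/memvZ/memv_span.
by apply: map_f; rewrite mem_enum.
Qed.

(* The test polynomial is a product of linear factors killing all the atoms
   except those at nu, times one more coordinate, which keeps the word nonempty
   and does not vanish at nu. *)
Lemma moments_atom (K : fieldType) (k : nat) (I : finType) (c : I -> K)
    (z : I -> 'rV[K]_k) :
  (forall w : seq 'I_k, w != [::] -> \sum_i c i * \prod_(r <- w) z i 0 r = 0) ->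
  forall nu, nu != 0 -> \sum_(i | z i == nu) c i = 0.
Proof.
move=> mom nu nu0.
(* An affine function of [x] vanishing at [u] but not at [nu]; the value [1] is reached only for
   [u = nu]. *)
pose sep (u x : 'rV[K]_k) : K :=
  if [pick r | u 0 r != nu 0 r] is Some r then x 0 r - u 0 r else 1.
have sep_nu u : sep u nu != 0.
  rewrite /sep; case: pickP => [r|_]; last exact: oner_neq0.
  by rewrite subr_eq0 eq_sym.
have sep_self u : u != nu -> sep u u = 0.
  rewrite /sep; case: pickP => [r _ _|eq_u]; first by rewrite subrr.
  case/eqP; apply/rowP => r; apply/eqP.
  by have /negbFE := eq_u r.
(* The induction runs over all nonempty words at once: in a factor [x_r - u_r] the first term
   lengthens the word by [r], the second keeps it. *)
have test (s : seq 'rV[K]_k) : forall w : seq 'I_k, w != [::] ->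
    \sum_i c i * (\prod_(u <- s) sep u (z i) * \prod_(r <- w) z i 0 r) = 0.
  elim: s => [|u s IH] w w0.
    by rewrite -[RHS](mom w w0); apply: eq_bigr => i _; rewrite big_nil mul1r.
  rewrite {1}/sep; under eq_bigr => i _ do rewrite big_cons /sep.
  case: pickP => [r _|_]; last first.
    by rewrite -[RHS](IH w w0); apply: eq_bigr => i _; rewrite mul1r.
  transitivity (
      \sum_i c i * (\prod_(u <- s) sep u (z i) * \prod_(r <- r :: w) z i 0 r)
      - u 0 r *
        \sum_i c i * (\prod_(u <- s) sep u (z i) * \prod_(r <- w) z i 0 r));
    last by rewrite !IH // mulr0 subr0.
  rewrite mulr_sumr -sumrB; apply: eq_bigr => i _; rewrite big_cons.
  by ring.
have [r nur] : exists r, nu 0 r != 0.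
  apply/existsP; apply: contraR nu0; rewrite negb_exists => /forallP nu_0.
  by apply/eqP/rowP => r; rewrite mxE; apply/eqP; rewrite -[_ == _]negbK nu_0.
pose s := [seq u <- [seq z i | i <- enum I] | u != nu].
have := test s [:: r] isT; rewrite (bigID (fun i => z i == nu)) /=.
rewrite [X in _ + X]big1 ?addr0 => [|i zi]; last first.
  have zis : z i \in s by rewrite mem_filter zi map_f ?mem_enum.
  by rewrite (big_rem _ zis) /= sep_self // !mul0r mulr0.
under eq_bigr => i /eqP -> do rewrite big_seq1.
rewrite -mulr_suml => /eqP; rewrite mulf_eq0 => /orP[/eqP //|].
rewrite mulf_eq0 (negPf nur) orbF prodf_seq_eq0 => /hasP[u _].
by rewrite (negPf (sep_nu u)) andbF.
Qed.

(** * The joint fields in coordinates *)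

Section Fields.
Context {R : realType} {n k : nat}.
Variables (Q : 'M[R]_n.+1) (lam : 'I_n.+1 -> 'rV[R]_k).

Local Notation N := (1 + (n + k))%N.
Local Notation a := (avec lam).
Local Notation U := (@joint_domain R n k).
Local Notation X0 := (with_time (-1) (fieldD0_hat Q lam)).
Local Notation V r := (with_time 0 (fieldD_tilde lam r)).
Implicit Types (p : 'rV[R]_N) (u : 'I_n -> R) (c : R).

Definition tidx : 'I_N := lshift (n + k) ord0.
Definition phidx (j : 'I_n) : 'I_N := rshift 1 (lshift k j).
Definition xidx (r : 'I_k) : 'I_N := rshift 1 (rshift n r).

Lemma joint_idxP (P : 'I_N -> Prop) :
  P tidx -> (forall j, P (phidx j)) -> (forall r, P (xidx r)) -> forall i, P i.
Proof.
move=> Pt Pphi Px i; case: (split_ordP i) => [j ->|j ->].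
  by rewrite ord1.
by case: (split_ordP j) => l ->; [exact: Pphi|exact: Px].
Qed.

Lemma big_joint_idx (f : 'I_N -> R) :
  \sum_i f i = f tidx + \sum_j f (phidx j) + \sum_r f (xidx r).
Proof. by rewrite big_split_ord big_ord1 big_split_ord /= addrA. Qed.

Lemma joint_domainP p : U p <-> forall j, 0 < p 0 (phidx j).
Proof. by split=> Up j; have := Up j; rewrite !mxE. Qed.

Lemma open_joint_domain : open U.
Proof.
rewrite openE => p /joint_domainP Up.
have : nbhs p (fun q : 'rV[R]_N => forall j, 0 < q 0 (phidx j)).
  apply: (@filter_forall _ _ (fun j q => 0 < q 0 (phidx j)) (nbhs p)) => j.
  have /(_ p) := @coord_continuous R 1 N 0 (phidx j).
  move=> /(_ [set x | 0 < x]); apply.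
  by apply: open_nbhs_nbhs; split; [exact: open_gt|exact: Up].
by apply: filterS => q qU; apply/joint_domainP.
Qed.

Definition phi (i : 'I_n.+1) p : R := phi_ext (lsubmx (rsubmx p)) i.

Lemma phi0 p : phi ord0 p = 1.
Proof. by rewrite /phi /phi_ext unlift_none. Qed.

Lemma phiS (j : 'I_n) p : phi (lift ord0 j) p = p 0 (phidx j).
Proof. by rewrite /phi /phi_ext liftK !mxE. Qed.

Lemma phi_gt0 i p : U p -> 0 < phi i p.
Proof.
move=> Up; case: (unliftP ord0 i) => [j ->|->]; last by rewrite phi0.
by rewrite phiS; move/joint_domainP: Up; apply.
Qed.

Lemma phi_neq0 i p : U p -> phi i p != 0.
Proof. by move=> /(phi_gt0 i)/lt0r_neq0. Qed.

Lemma smooth_phi i : smooth U (phi i).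
Proof.
case: (unliftP ord0 i) => [j ->|->].
  apply: (smooth_congr open_joint_domain) (smooth_coord open_joint_domain _).
  by move=> p _; rewrite phiS.
apply: (smooth_congr open_joint_domain) (smooth_cst open_joint_domain 1).
by move=> p _; rewrite phi0.
Qed.

(** With [w_0 = 0], this is the exponential of [w_i - w_j + (a_i - a_j) . x], hence an eigenfunction
    of each [V r], with eigenvalue the [r]-th coordinate of the frequency [a_i - a_j]. *)
Definition phi_ratio (i j : 'I_n.+1) p : R := phi i p / phi j p.

Lemma smooth_phiV i : smooth U (fun p => (phi i p)^-1).
Proof.
apply: (smoothV open_joint_domain); last exact: smooth_phi.
by move=> p; exact: phi_neq0.
Qed.

Lemma smooth_phi_ratio i j : smooth U (phi_ratio i j).
Proof.
exact: (smoothM open_joint_domain) (smooth_phi i) (smooth_phiV j).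
Qed.

Definition ytot p : R := ysum (lsubmx (rsubmx p)).

Lemma ytotE p : ytot p = 1 + \sum_j p 0 (phidx j).
Proof. by rewrite /ytot /ysum; under eq_bigr => j _ do rewrite !mxE. Qed.

Lemma ytot_neq0 p : U p -> ytot p != 0.
Proof.
move=> /joint_domainP Up; rewrite ytotE gt_eqF // ltr_pwDl //.
by apply: sumr_ge0 => j _; exact: ltW.
Qed.

Lemma smooth_ytotV : smooth U (fun p => (ytot p)^-1).
Proof.
have Uo := open_joint_domain.
apply: (smoothV Uo); first exact: ytot_neq0.
apply: (smooth_congr Uo (f := fun p => 1 + \sum_j p 0 (phidx j))).
  by move=> p _; rewrite ytotE.
apply: (smoothD Uo); first exact: smooth_cst.
by apply: (smooth_sum Uo) => j; exact: smooth_coord.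
Qed.

Lemma X_t r p : V r p 0 tidx = 0.
Proof. by rewrite row_mxEl mxE. Qed.

Lemma X_phi r j p : V r p 0 (phidx j) = a (lift ord0 j) 0 r * p 0 (phidx j).
Proof. by rewrite row_mxEr row_mxEl !mxE. Qed.

Lemma X_x r s p : V r p 0 (xidx s) = (s == r)%:R.
Proof. by rewrite row_mxEr row_mxEr mxE eqxx. Qed.

Lemma X0_t p : X0 p 0 tidx = -1.
Proof. by rewrite row_mxEl mxE. Qed.

Lemma X0_phi j p : X0 p 0 (phidx j) =
  (ytot p)^-1 * (\sum_i Sigma lam (lift ord0 i) (lift ord0 j)
                   * p 0 (phidx i) * p 0 (phidx j))
  - 2^-1 * dot (a (lift ord0 j)) (a (lift ord0 j)) * p 0 (phidx j)
  + \sum_i (Q i (lift ord0 j) - Q i ord0 * p 0 (phidx j)) * phi i p.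
Proof.
rewrite row_mxEr row_mxEl /fieldD0J mxE [X in X + _]mxE [X in _ + X]mxE.
rewrite -/(ytot p) !mxE; congr (_ * _ - _ + _).
by apply: eq_bigr => i _; rewrite !mxE.
Qed.

Lemma X0_x r p : X0 p 0 (xidx r) =
  (ytot p)^-1 * (lam ord0 0 r + \sum_i lam (lift ord0 i) 0 r * p 0 (phidx i)).
Proof.
rewrite row_mxEr row_mxEr mxE /lambda_tilde -/(ytot p); congr (_ * (_ + _)).
by apply: eq_bigr => i _; rewrite !mxE.
Qed.

Lemma smooth_X r : smooth_field U (V r).
Proof.
have Uo := open_joint_domain.
apply: joint_idxP => [|j|s].
- by apply: (smooth_congr Uo) (smooth_cst Uo 0) => p _; rewrite X_t.
- apply: (smooth_congr Uo) (smoothM Uo (smooth_cst Uo _) (smooth_coord Uo _)).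
  by move=> p _; rewrite X_phi.
- by apply: (smooth_congr Uo) (smooth_cst Uo _) => p _; rewrite X_x.
Qed.

Lemma smooth_X0 : smooth_field U X0.
Proof.
have Uo := open_joint_domain.
pose sc c := smooth_cst Uo c; pose sp j := smooth_coord Uo (phidx j).
apply: joint_idxP => [|j|s].
- by apply: (smooth_congr Uo) (sc (-1)) => p _; rewrite X0_t.
- apply: (smooth_congr Uo (fun p _ => esym (X0_phi j p))).
  apply: (smoothD Uo); first apply: (smoothD Uo).
  + apply: (smoothM Uo); first exact: smooth_ytotV.
    apply: (smooth_sum Uo) => i; apply: (smoothM Uo) (sp j).
    exact: (smoothM Uo) (sc _) (sp i).
  + by apply: (smoothN Uo); apply: (smoothM Uo) (sc _) (sp j).
  + apply: (smooth_sum Uo) => i; apply: (smoothM Uo) (smooth_phi i).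
    apply: (smoothD Uo) (sc _) _; apply: (smoothN Uo).
    exact: (smoothM Uo) (sc _) (sp j).
- apply: (smooth_congr Uo (fun p _ => esym (X0_x s p))).
  apply: (smoothM Uo); first exact: smooth_ytotV.
  apply: (smoothD Uo) (sc _) _; apply: (smooth_sum Uo) => i.
  exact: (smoothM Uo) (sc _) (sp i).
Qed.

Lemma avec0 : a ord0 = 0.
Proof. exact: subrr. Qed.

Lemma vf_apply_X_phi r i p : vf_apply (V r) (phi i) p = a i 0 r * phi i p.
Proof.
case: (unliftP ord0 i) => [j ->|->].
  rewrite phiS -X_phi -vf_apply_coord; congr vf_apply.
  by apply/funext => q; rewrite phiS.
rewrite avec0 mxE mul0r -[RHS](vf_apply_cst (V r) 1 p); congr vf_apply.
by apply/funext => q; rewrite phi0.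
Qed.

Lemma vf_apply_X_phi_ratio r i j p : U p ->
  vf_apply (V r) (phi_ratio i j) p = (a i - a j) 0 r * phi_ratio i j p.
Proof.
move=> Up; have Uo := open_joint_domain.
rewrite (vf_applyM (V r) Up (smooth_phi i) (smooth_phiV j)).
rewrite (vf_applyV (V r) Up (fun q => @phi_neq0 j q) (smooth_phi j)).
have -> : (a i - a j) 0 r = a i 0 r - a j 0 r by rewrite !mxE.
rewrite !vf_apply_X_phi /phi_ratio.
by field; exact: phi_neq0.
Qed.

(** * Constant-coefficient forms vanishing on the [V r] *)

(** Position 0 is time, positions 1 to [n] are the [phi_j], the remaining ones are the [x_r]. *)
Definition is_phidx (i : 'I_N) : bool := (0 < i <= n)%N.

Lemma is_phidx_t : is_phidx tidx = false.
Proof. by []. Qed.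

Lemma is_phidx_phi j : is_phidx (phidx j) = true.
Proof. by rewrite /is_phidx /= add1n ltn_ord. Qed.

Lemma is_phidx_x r : is_phidx (xidx r) = false.
Proof. by rewrite /is_phidx /= add1n ltnNge leq_addr. Qed.

Lemma is_phidx_neq0 p i : U p -> is_phidx i -> p 0 i != 0.
Proof.
move=> Up; elim/joint_idxP: i => [//|j _|r]; last by rewrite is_phidx_x.
by rewrite gt_eqF //; move/joint_domainP: Up; apply.
Qed.

Lemma logscale_t p : logscale is_phidx tidx p = 1.
Proof. by rewrite /logscale is_phidx_t. Qed.

Lemma logscale_phi j p : logscale is_phidx (phidx j) p = p 0 (phidx j).
Proof. by rewrite /logscale is_phidx_phi. Qed.

Lemma logscale_x r p : logscale is_phidx (xidx r) p = 1.
Proof. by rewrite /logscale is_phidx_x. Qed.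

(* The form c dt + sum_j u_j d(log phi_j - a_j . x); these are the forms which
   vanish on the V r. *)
Definition wform c u : 'I_N -> R :=
  row_mx c%:M (row_mx (\row_j u j) (- \sum_j u j *: a (lift ord0 j))) 0.

Local Notation Theta c u := (log_form is_phidx (wform c u)).

Lemma ThetaE c u F p : Theta c u F p = c * F p 0 tidx + \sum_j u j *
  (F p 0 (phidx j) / p 0 (phidx j)
   - \sum_r a (lift ord0 j) 0 r * F p 0 (xidx r)).
Proof.
rewrite /log_form big_joint_idx -addrA; congr (_ + _).
  by rewrite /wform row_mxEl mxE logscale_t divr1.
under [X in _ = X]eq_bigr => j _ do rewrite mulrBr.
rewrite sumrB; congr (_ + _).
  by apply: eq_bigr => j _; rewrite /wform row_mxEr row_mxEl mxE logscale_phi.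
under eq_bigr => r _.
  rewrite /wform row_mxEr row_mxEr logscale_x divr1 mxE summxE mulNr mulr_suml.
  over.
rewrite sumrN exchange_big; congr (- _); apply: eq_bigr => j _ /=.
by rewrite mulr_sumr; apply: eq_bigr => r _; rewrite mxE mulrA.
Qed.

Lemma Theta_X c u r p : U p -> Theta c u (V r) p = 0.
Proof.
move=> /joint_domainP Up; rewrite ThetaE X_t mulr0 add0r big1 // => j _.
rewrite X_phi mulfK ?gt_eqF // (bigD1 r) //= X_x eqxx mulr1 big1 ?addr0.
  by rewrite subrr mulr0.
by move=> s /negPf sr; rewrite X_x sr mulr0.
Qed.

(** Converse of [Theta_X]: the [x]-part of [V r] is a basis vector, so vanishing on [V r] determines
    the [x_r] coefficient. One point is enough because the logarithmic coefficients of [V r] are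
    constant. *)
Lemma wform_unique xi p : U p ->
  (forall r, log_form is_phidx xi (V r) p = 0) ->
  xi =1 wform (xi tidx) (xi \o phidx).
Proof.
move=> Up xiX; elim/joint_idxP => [|j|r].
- by rewrite /wform row_mxEl mxE.
- by rewrite /wform row_mxEr row_mxEl mxE.
rewrite /wform row_mxEr row_mxEr mxE summxE; apply/eqP; rewrite -addr_eq0.
rewrite -[X in _ == X](xiX r) /log_form big_joint_idx X_t mul0r mulr0 add0r.
rewrite addrC; apply/eqP; congr (_ + _).
  apply: eq_bigr => j _; rewrite X_phi logscale_phi mxE mulfK //.
  by rewrite gt_eqF //; move/joint_domainP: Up; apply.
rewrite (bigD1 r) //= X_x logscale_x eqxx divr1 mulr1 big1 ?addr0 // => s sr.
by rewrite X_x (negPf sr) mul0r mulr0.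
Qed.

(* The value at 0 makes the coefficient of phi_i / phi_j uniform in j = 0, ..., n,
   because phi_0 = 1. *)
Definition ext0 u (i : 'I_n.+1) : R :=
  if unlift ord0 i is Some j then u j else - \sum_j u j.

(** The constant in the [w_j]-component of the drift field, apart from the diagonal rate [q_jj]. *)
Definition drift (j : 'I_n) : R :=
  - (2^-1 * dot (a (lift ord0 j)) (a (lift ord0 j))
     + dot (a (lift ord0 j)) (lam ord0)).

(** The quotient by [y] in [D_0] cancels against [a_j . lambda_tilde], since [lambda_tilde =
    lambda_0 + y^-1 sum_i a_i phi_i]. Only the jump terms still depend on [phi]. *)
Lemma X0_log_coef j p : U p ->
  X0 p 0 (phidx j) / p 0 (phidx j)
    - \sum_r a (lift ord0 j) 0 r * X0 p 0 (xidx r)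
  = drift j
    + \sum_i (Q i (lift ord0 j) * phi_ratio i (lift ord0 j) p
              - Q i ord0 * phi_ratio i ord0 p).
Proof.
move=> Up; have y0 := ytot_neq0 Up; have := joint_domainP p => -[/(_ Up) pp _].
have pj0 : p 0 (phidx j) != 0 by rewrite gt_eqF.
rewrite X0_phi mulrDl mulrBl mulfK // -!mulrA.
have -> : (\sum_i Sigma lam (lift ord0 i) (lift ord0 j)
    * p 0 (phidx i) * p 0 (phidx j)) / p 0 (phidx j)
    = \sum_i dot (a (lift ord0 j)) (a (lift ord0 i)) * p 0 (phidx i).
  rewrite mulr_suml; apply: eq_bigr => i _; rewrite mulfK //.
  by congr (_ * _); apply: eq_bigr => r _; rewrite mulrC.
have -> : \sum_r a (lift ord0 j) 0 r * X0 p 0 (xidx r)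
  = dot (a (lift ord0 j)) (lam ord0) + (ytot p)^-1 *
    \sum_i dot (a (lift ord0 j)) (a (lift ord0 i)) * p 0 (phidx i).
  (* Uses [y = 1 + sum_i phi_i] to replace each [lambda_i] by [lambda_0 + a_i]. *)
  have lamE r : X0 p 0 (xidx r) = lam ord0 0 r
      + (ytot p)^-1 * \sum_i a (lift ord0 i) 0 r * p 0 (phidx i).
    apply: (mulfI y0); rewrite X0_x mulVKf // mulrDr mulVKf // ytotE mulrDl mul1r -addrA.
    congr (_ + _); rewrite mulr_suml -big_split; apply: eq_bigr => i _ /=.
    by rewrite !mxE; ring.
  under eq_bigr => r _ do rewrite lamE mulrDr mulrCA.
  rewrite big_split -mulr_sumr; congr (_ + _ * _).
  under eq_bigr => r _ do rewrite mulr_sumr.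
  rewrite exchange_big; apply: eq_bigr => i _ /=.
  by rewrite /dot mulr_suml; apply: eq_bigr => r _; rewrite mulrA.
have -> : (\sum_i (Q i (lift ord0 j) - Q i ord0 * p 0 (phidx j)) * phi i p)
    / p 0 (phidx j)
    = \sum_i (Q i (lift ord0 j) * phi_ratio i (lift ord0 j) p
              - Q i ord0 * phi_ratio i ord0 p).
  rewrite mulr_suml; apply: eq_bigr => i _.
  by rewrite /phi_ratio phiS phi0; field.
by rewrite /drift; ring.
Qed.

(** The terms [- q_i0 phi_i], common to all [j], become the summand of index 0. The diagonal
    summands are constants of frequency zero, kept inside the double sum. *)
Lemma Theta_X0 c u p : U p ->
  Theta c u X0 p = \sum_j u j * drift j - c
    + \sum_j \sum_i ext0 u j * Q i j * phi_ratio i j p.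
Proof.
move=> Up; rewrite ThetaE X0_t mulrN1 addrC addrAC; congr (_ - _).
under eq_bigr => j _ do rewrite X0_log_coef // mulrDr.
rewrite big_split /=; congr (_ + _).
have -> : \sum_j \sum_i ext0 u j * Q i j * phi_ratio i j p
  = \sum_j u j * \sum_i Q i (lift ord0 j) * phi_ratio i (lift ord0 j) p
    - \sum_j u j * \sum_i Q i ord0 * phi_ratio i ord0 p.
  rewrite big_ord_recl addrC -mulr_suml -mulNr mulr_sumr; congr (_ + _).
    apply: eq_bigr => j _; rewrite mulr_sumr; apply: eq_bigr => i _.
    by rewrite /ext0 liftK -mulrA.
  by apply: eq_bigr => i _; rewrite /ext0 unlift_none -mulrA.
by rewrite -sumrB; apply: eq_bigr => j _; rewrite sumrB mulrBr.
Qed.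

(** * Repeated brackets of [X0] with the [V r] *)

Definition ad_word (w : seq 'I_k) : vfield R N :=
  foldr (fun r F => lie_bracket (V r) F) X0 w.

Lemma iterated_ad_word w :
  iterated_bracket ([set X0] `|` range (fun r => V r)) (ad_word w).
Proof.
elim: w => [|r w IH]; first by apply: iterated_bracket_gen; left.
apply: iterated_bracket_lie IH; apply: iterated_bracket_gen.
by right; exists r.
Qed.

Lemma smooth_ad_word w : smooth_field U (ad_word w).
Proof.
elim: w => [|r w IH]; first exact: smooth_X0.
by apply: (smooth_lie open_joint_domain) IH; exact: smooth_X.
Qed.

(** The form is closed and vanishes on [V r], so its value on [[V r, F]] is [V r] applied to its
    value on [F]. This kills the constant and multiplies each ratio by its eigenvalue. *)
Lemma Theta_ad_word c u w p : U p ->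
  Theta c u (ad_word w) p = (\sum_j u j * drift j - c) *+ (w == [::])
    + \sum_j \sum_i ext0 u j * Q i j * (\prod_(r <- w) (a i - a j) 0 r)
                    * phi_ratio i j p.
Proof.
have Uo := open_joint_domain.
elim: w p => [|r w IH] p Up.
  rewrite Theta_X0 // eqxx; congr (_ + _).
  by apply: eq_bigr => j _; apply: eq_bigr => i _; rewrite big_nil mulr1.
have sX := @smooth_X r; have sw := @smooth_ad_word w.
rewrite (log_form_bracket Uo is_phidx_neq0 (wform c u) Up sX sw).
rewrite (vf_apply_congr Uo (ad_word w) Up (fun q => @Theta_X c u r q)).
rewrite (vf_apply_congr Uo (V r) Up IH) vf_apply_cst subr0 add0r.
have sr i j d : smooth U (fun q => d * phi_ratio i j q).
  exact: (smoothM Uo) (smooth_cst Uo d) (smooth_phi_ratio i j).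
rewrite (vf_applyD (V r) Up (smooth_cst Uo _)); last first.
  by do 2! apply: (smooth_sum Uo) => ?; exact: sr.
rewrite vf_apply_cst add0r (vf_apply_sum Uo); [|by []|move=> j]; last first.
  by apply: (smooth_sum Uo) => i; exact: sr.
apply: eq_bigr => j _; rewrite (vf_apply_sum Uo) //; apply: eq_bigr => i _.
rewrite (vf_applyZ Uo (V r) _ Up (smooth_phi_ratio i j)).
rewrite vf_apply_X_phi_ratio // big_cons.
by rewrite mulrA; congr (_ * _); rewrite -!mulrA; congr (_ * (_ * _)); rewrite mulrC.
Qed.

End Fields.

(** * Failure and validity of the bracket condition *)

(* Two of the w_j = log phi_j - a_j . x have drifts which differ by a constant,
   so that w_j - w_j' - c t is a first integral. *)
Lemma not_joint_hormander (R : realType) (n k : nat) (Q : 'M[R]_n.+1)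
    (lam : 'I_n.+1 -> 'rV[R]_k) : (1 < n)%N ->
  (forall j m : 'I_n.+1, j != ord0 -> m != j -> Q m j = 0) ->
  ~ joint_hormander Q lam.
Proof.
move=> n1 Q0 H.
pose j1 := Ordinal (ltnW n1); pose j2 := Ordinal n1.
(* The coefficients of [w_1 - w_2]; they sum to zero, so [ext0 u] vanishes at 0 and the terms
   [- q_i0 phi_i] disappear. *)
pose u (j : 'I_n) : R := (j == j1)%:R - (j == j2)%:R.
have usum : \sum_j u j = 0.
  have sum1 (i : 'I_n) : \sum_j (j == i)%:R = 1 :> R.
    by rewrite (bigD1 i) //= eqxx big1 ?addr0 // => j /negPf ->.
  by rewrite sumrB !sum1 subrr.
(* Chosen to cancel what remains: the drifts and the diagonal rates. *)
pose c := \sum_j u j * (drift lam j + Q (lift ord0 j) (lift ord0 j)).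
have Theta0 p : joint_domain p -> log_form (@is_phidx n k) (wform lam c u)
    (with_time (-1) (fieldD0_hat Q lam)) p = 0.
  move=> Up; rewrite Theta_X0 //.
  rewrite big_ord_recl [X in _ + (X + _)]big1 => [|i _]; last first.
    by rewrite /ext0 unlift_none usum oppr0 !mul0r.
  rewrite add0r [X in _ + X](_ : _ =
      \sum_j u j * Q (lift ord0 j) (lift ord0 j)); last first.
    apply: eq_bigr => j _; rewrite (bigD1 (lift ord0 j)) //= big1 => [|i ij].
      by rewrite addr0 /ext0 liftK /phi_ratio mulfV ?mulr1 //; exact: phi_neq0.
    by rewrite (Q0 (lift ord0 j)) // mulr0 mul0r.
  rewrite addrAC -big_split /c /=; under eq_bigr => j _ do rewrite -mulrDr.
  by rewrite subrr.
(* At the point with all coordinates 1 every [logscale] is 1, so the logarithmic form is the plain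
   pairing with [wform]. *)
pose p : 'rV[R]_(1 + (n + k)) := const_mx 1.
have Up : joint_domain p by apply/joint_domainP => j; rewrite mxE.
have [s [sF sfull]] := H p Up.
suff /(_ (@phidx n k j1))/eqP : forall i, wform lam c u i = 0.
  by rewrite /wform row_mxEr row_mxEl mxE /u eqxx subr0 oner_eq0.
apply: (span_full_annihilator sfull) => v /sF[F itF ->].
have [_ F0] : smooth_field (@joint_domain R n k) F /\ forall q, joint_domain q ->
    log_form (@is_phidx n k) (wform lam c u) F q = 0.
  apply: (log_form_iterated (@open_joint_domain R n k) (@is_phidx_neq0 R n k))
    itF => G [->|[r _ <-]]; [exact: smooth_X0|exact: smooth_X|exact: Theta0|].
  by move=> q Uq; exact: Theta_X.
rewrite -[RHS](F0 p Up); apply: eq_bigr => i _; congr (_ * _).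
by rewrite /logscale mxE if_same divr1.
Qed.

(** A covector annihilating all brackets at [p] is a [wform]; its values on the [ad_word] fields are
    moments of the frequencies, which [moments_atom] separates. *)
Lemma joint_hormander_separated (R : realType) (n k : nat) (Q : 'M[R]_n.+1)
    (lam : 'I_n.+1 -> 'rV[R]_k) :
  (forall i j : 'I_n.+1, i != j -> 0 <= Q i j) ->
  injective (avec lam) ->
  (forall i : 'I_n.+1, i != ord0 ->
     exists m : 'I_n.+1,
       [/\ m != i,
           0 < Q m i &
           forall p j : 'I_n.+1, 0 < Q p j ->
             avec lam p - avec lam j = avec lam m - avec lam i ->
             j = i]) ->
  joint_hormander Q lam.
Proof.
move=> Qoff ainj sep p Up.
pose S : set 'rV[R]_(1 + (n + k)) := [set v | exists2 F, iterated_bracket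
  ([set with_time (-1) (fieldD0_hat Q lam)]
     `|` range (fun r => with_time 0 (fieldD_tilde lam r))) F & v = F p].
apply: (@span_full_of_annihilator _ _ S) => xi xi0.
have ls0 i := logscale_neq0 (@is_phidx_neq0 R n k) i Up.
(* Rescaling converts the plain pairing at [p] into a [log_form]. *)
pose zeta i := logscale (@is_phidx n k) i p * xi i.
suff zeta0 i : zeta i = 0.
  by move=> i; have /eqP := zeta0 i; rewrite mulf_eq0 (negPf (ls0 i)) => /eqP.
have zetaF F : S (F p) -> log_form (@is_phidx n k) zeta F p = 0.
  move=> SF; rewrite -[RHS](xi0 _ SF); apply: eq_bigr => l _.
  by rewrite /zeta mulrAC mulrCA mulfV // mulr1 mulrC.
have zetaX r : log_form (@is_phidx n k) zeta
    (with_time 0 (fieldD_tilde lam r)) p = 0.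
  apply: zetaF; exists (with_time 0 (fieldD_tilde lam r)) => //.
  by apply: iterated_bracket_gen; right; exists r.
have zetaE := wform_unique Up zetaX.
set c := zeta _ in zetaE; set u := _ \o _ in zetaE.
have Theta0 w : log_form (@is_phidx n k) (wform lam c u) (ad_word Q lam w) p = 0.
  rewrite -[RHS](zetaF (ad_word Q lam w)); last first.
    by exists (ad_word Q lam w) => //; exact: iterated_ad_word.
  by apply: eq_bigr => l _; rewrite zetaE.
have u0 j : u j = 0.
  have [|m [mj Qmj sepm]] := sep (lift ord0 j); first by rewrite eq_sym neq_lift.
  pose nu := avec lam m - avec lam (lift ord0 j).
  have nu0 : nu != 0 by rewrite subr_eq0 (inj_eq ainj).
  have := @moments_atom _ _ _
    (fun x : 'I_n.+1 * 'I_n.+1 => ext0 u x.2 * Q x.1 x.2 * @phi_ratio R n k x.1 x.2 p)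
    (fun x => avec lam x.1 - avec lam x.2) _ nu nu0.
  (* A nonzero frequency excludes the diagonal, where [Q] may be negative. *)
  have Qge0 x : avec lam x.1 - avec lam x.2 == nu -> 0 <= Q x.1 x.2.
    move=> /eqP xnu; apply: Qoff; apply: contra nu0 => /eqP x12.
    by rewrite -xnu x12 subrr.
  (* Pairs of frequency [nu] with zero rate contribute nothing; the others have second index
     [lift ord0 j] by separation. So [u j] factors out of a sum that is positive thanks to the pair
     formed by [m] and [lift ord0 j]. *)
  under eq_bigr => x xnu.
    rewrite (_ : ext0 u x.2 * Q x.1 x.2 = u j * Q x.1 x.2); last first.
      have := Qge0 x xnu; rewrite le_eqVlt => /predU1P[<-|Qx].
        by rewrite !mulr0.
      by rewrite (sepm _ _ Qx (eqP xnu)) /ext0 liftK.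
    rewrite -mulrA.
    over.
  rewrite -mulr_sumr => uj0.
  have : u j * \sum_(x : 'I_n.+1 * 'I_n.+1 | avec lam x.1 - avec lam x.2 == nu)
             Q x.1 x.2 * @phi_ratio R n k x.1 x.2 p = 0.
    apply: uj0 => w w0; rewrite -[RHS](Theta0 w) Theta_ad_word // (negPf w0).
    rewrite mulr0n add0r exchange_big pair_bigA /=; apply: eq_bigr => x _.
    by rewrite mulrAC.
  move=> /eqP; rewrite mulf_eq0 => /orP[/eqP //|]; rewrite gt_eqF //.
  have rgt0 i' l : 0 < @phi_ratio R n k i' l p by rewrite divr_gt0 ?phi_gt0.
  rewrite (bigD1 (m, lift ord0 j)) //=; apply: ltr_pwDl.
    by apply: mulr_gt0; [exact: Qmj|exact: rgt0].
  apply: sumr_ge0 => x /andP[xnu _]; apply: mulr_ge0; first exact: Qge0.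
  exact: ltW.
have c0 : c = 0.
  (* Once [u] vanishes, the time component [-1] of [X0] forces [c = 0]. *)
  have := Theta0 [::]; rewrite ThetaE X0_t big1 => [|j _].
    by rewrite addr0 mulrN1 => /eqP; rewrite oppr_eq0 => /eqP.
  by rewrite u0 mul0r.
rewrite zetaE; move: i; apply: joint_idxP => [|j|r]; rewrite /wform.
- by rewrite row_mxEl mxE c0.
- by rewrite row_mxEr row_mxEl mxE u0.
- rewrite row_mxEr row_mxEr big1 ?oppr0 ?mxE // => j _.
  by rewrite u0 scale0r.
Qed.

Theorem proposition5p5 (R : realType) (n k : nat)
    (hk : (1 <= k)%N) (hkn : (k < n)%N)
    (Q : 'M[R]_n.+1)
    (hQoff : forall i j : 'I_n.+1, i != j -> 0 <= Q i j)
    (hQdiag : forall i : 'I_n.+1, Q i i <= 0)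
    (hQsum : forall i : 'I_n.+1, \sum_(j < n.+1) Q i j = 0)
    (lam : 'I_n.+1 -> 'rV[R]_k)
    (hlam : injective lam)
    (hvertex : vertex (convex_hull lam) (lam ord0)) :
  ((Q = 0
    \/ ((forall j m : 'I_n.+1, j != ord0 -> m != j -> Q m j = 0)
        /\ (exists j : 'I_n.+1, j != ord0 /\ 0 < Q j ord0))) ->
   ~ joint_hormander Q lam)
  /\
  (injective (avec lam) ->
   (forall i : 'I_n.+1, i != ord0 ->
      exists m : 'I_n.+1,
        [/\ m != i,
            0 < Q m i &
            forall p j : 'I_n.+1, 0 < Q p j ->
              avec lam p - avec lam j = avec lam m - avec lam i ->
              j = i]) ->
   joint_hormander Q lam).
Proof.
split.
  (* From [1 <= k < n] there are two indices to compare, and in either case the columns other than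
     column 0 vanish off the diagonal. *)
  move=> Qcase; apply: not_joint_hormander; first exact: leq_trans hkn.
  by case: Qcase => [-> j m _ _|[]//]; rewrite mxE.
exact: joint_hormander_separated.
Qed.
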